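(* Let $(\mathfrak{r},\mathfrak{p})$ be a finite local principal ring with residue field $\mathfrak{r}/\mathfrak{p} \cong \mathbb{F}_q$ and length $v$. Let $n,N,r \in \mathbb{Z}^+$. Let $f_1,\ldots,f_n \in \mathfrak{r}[t_1,\ldots,t_N]$ be $\mathfrak{r}$-linearly independent, and let $V = \langle f_1,\ldots,f_n\rangle$ be the $\mathfrak{r}$-module spanned by $f_1,\ldots,f_n$, so that every $f \in V$ may be uniquely written as $f = \sum_{i=1}^n c_i(f) f_i$ with $c_i(f) \in \mathfrak{r}$. Let $X = \{x_j\}_{j=1}^r \subset \mathfrak{r}^N$ be finite of cardinality $r$. Let $A_1,\ldots,A_n,B_1,\ldots,B_r \subset \mathfrak{r}$ satisfy Condition (F). For $1 \le j \le r$, let $v_j$ be an integer with $1 \le v_j \le v$. Let $\mathcal{S}$ be the set of $f \in V$ such that (i) $c_i(f) \in A_i$ for all $1 \le i \le n$, and (ii) $f(x_j) \in B_j \pmod{\mathfrak{p}^{v_j}}$ for all $1 \le j \le r$. (a) Then $\# \mathcal{S} = 0$ or $$\# \mathcal{S} \ge \mathfrak{m}\Big(\# A_1,\ldots,\# A_n;\ \sum_{i=1}^n \# A_i - \sum_{j=1}^r (q^{v_j}-\# B_j)\Big).$$ (b) Suppose that $0$ is an element of each $A_i$ and each $B_j$ and that $$\sum_{i=1}^n \# A_i - \sum_{j=1}^r (q^{v_j}-\# B_j) > n.$$ Then there is $f \in \mathcal{S}$ with $f \ne 0$.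
   Context: A principal ring is a commutative ring in which every ideal is principal; a ring is local if it has exactly one maximal ideal. For a finite local principal ring $(\mathfrak{r},\mathfrak{p})$, the length is the positive integer $v$ such that $\mathfrak{p}^{v-1} \ne (0)$ and $\mathfrak{p}^v = (0)$ (with $\mathfrak{p}^0=\mathfrak{r}$). A subset $A$ of a ring satisfies Condition (F) if it is nonempty, finite, and $x-y$ is a unit for any distinct $x,y \in A$. For a ring $R$, a subset $B \subset R$, an ideal $I$ of $R$ and $x \in R$, ''$x \in B \pmod I$'' means that there is $b \in B$ with $x - b \in I$. For $n,a_1,\ldots,a_n \in \mathbb{Z}^+$ and an integer $M \le \sum_{i=1}^n a_i$, put $\mathfrak{m}(a_1,\ldots,a_n;M) = 1$ if $M < n$, and, if $n \le M \le \sum_{i=1}^n a_i$, let $\mathfrak{m}(a_1,\ldots,a_n;M)$ be the minimum of $\prod_{i=1}^n y_i$ over all $(y_1,\ldots,y_n) \in \mathbb{Z}^n$ with $1 \le y_i \le a_i$ for all $i$ and $\sum_{i=1}^n y_i = M$. *)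

(* Defs.v *)
From HB Require Import structures.
From mathcomp Require Export all_boot all_order all_algebra finmap.
From mathcomp Require Export ring_quotient.
From mathcomp Require Export mpoly.

Set Implicit Arguments.
Unset Strict Implicit.
Unset Printing Implicit Defensive.

Import GRing.Theory.
Local Open Scope ring_scope.

Section FiniteRings.

Variable R : finComUnitRingType.
Implicit Types (I J A B : {set R}) (x : R).

Definition is_ideal I : bool :=
  (0 \in I) && [forall a, forall x in I, forall y in I, a * x + y \in I].

Definition principal_ring : Prop :=
  forall I, is_ideal I -> exists a, I = [set a * x | x : R].

Definition proper_ideal_set I : bool := is_ideal I && (I != [set: R]).

Definition maximal_ideal I : bool := maxset proper_ideal_set I.

(* R is local, with I its unique maximal ideal. *)
Definition local_ring I : Prop := forall J, maximal_ideal J <-> J = I.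

Definition ideal_gen A : {set R} :=
  \bigcap_(I : {set R} | is_ideal I && (A \subset I)) I.

Definition ideal_mul I J : {set R} :=
  ideal_gen [set x * y | x in I, y in J].

Definition ideal_exp I (k : nat) : {set R} := iter k (ideal_mul I) [set: R].

Definition ring_length I (v : nat) : Prop :=
  [/\ (0 < v)%N, ideal_exp I v.-1 <> [set 0] & ideal_exp I v = [set 0]].

(* Finiteness is automatic since R is finite. *)
Definition condF A : Prop :=
  A != set0 /\ {in A &, forall x y, x != y -> x - y \is a GRing.unit}.

Definition in_mod B I x : bool := [exists b in B, x - b \in I].

Section Span.

Variables (n N : nat) (f : 'I_n -> {mpoly R[N]}).

Definition lincomb (c : {ffun 'I_n -> R}) : {mpoly R[N]} :=
  \sum_(i < n) c i *: f i.

Definition lin_indep : Prop :=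
  forall c : {ffun 'I_n -> R}, lincomb c = 0 -> forall i, c i = 0.

Definition span : {fset {mpoly R[N]}} :=
  [fset lincomb c | c : {ffun 'I_n -> R}]%fset.

(* The coordinates c_i(g) of g in span; 0 is a junk value outside span.
   They are uniquely determined when lin_indep holds. *)
Definition coords (g : {mpoly R[N]}) : {ffun 'I_n -> R} :=
  odflt [ffun=> 0] [pick c : {ffun 'I_n -> R} | lincomb c == g].

Variables (P : {set R}) (r : nat) (X : 'I_r -> {ffun 'I_N -> R}).
Variables (A : 'I_n -> {set R}) (B : 'I_r -> {set R}) (w : 'I_r -> nat).

Definition solutions : {fset {mpoly R[N]}} :=
  [fset g in span |
     [forall i, coords g i \in A i] &&
     [forall j, in_mod (B j) (ideal_exp P (w j)) g.@[X j]]]%fset.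

End Span.

End FiniteRings.

(* For n <= M <= \sum_i a i the range of the minimum is nonempty, and every
   term is at most the initial value \prod_i a i, so this is the true minimum.
   Any y with y i <= a i takes values in 'I_(\sum_i a i).+1. *)
Definition frakm (n : nat) (a : 'I_n -> nat) (M : int) : nat :=
  if M < n%:Z then 1%N else
  \big[minn/(\prod_(i < n) a i)%N]_(y : {ffun 'I_n -> 'I_(\sum_(i < n) a i).+1}
       | [forall i, (1 <= y i <= a i)%N]
         && ((\sum_(i < n) y i)%N%:Z == M))
     (\prod_(i < n) y i)%N.

(* Main.v *)
(* Write [z] for a generator of the maximal ideal and [rho] for the reduction
   to [F_q].  The evaluations [f |-> f(x_j)] are linear in the coefficient
   vector, which ranges over a grid whose sides inject into [F_q].  By the
   Alon-Furedi theorem it suffices to detect each condition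
   [h in B mod z^w], for [h] of degree [d], by the nonvanishing modulo [z] of a
   polynomial of degree at most [d * (q^w - #B)].  Let [s] be a section of [rho]
   extending [B].  The product of [h - s u] over the [u] outside [rho B] detects
   the condition for [w = 1].  The product of [h - s u] over all [u] takes
   values divisible by [z] on the grid; since differences of grid coordinates
   are units, interpolation rewrites it there as [z * h'] with [h'] again a
   polynomial, of degree at most [q * d], and the condition for [w] is the one
   for [w = 1] together with [h' = 0 mod z^(w-1)]. *)
Require Import Defs.
From mathcomp Require Import ring zify.

Set Implicit Arguments.
Unset Strict Implicit.
Unset Printing Implicit Defensive.

Import GRing.Theory.
Local Open Scope ring_scope.

Definition upd (I : eqType) (T : Type) (u : I -> T) (i : I) (b : T) : I -> T :=
  fun j => if j == i then b else u j.

Lemma big_upd (I : finType) (T : Type) (S : Type) (idx : S)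
    (op : Monoid.com_law idx) (F : T -> S) (u : I -> T) i b :
  \big[op/idx]_j F (upd u i b j) = op (F b) (\big[op/idx]_(j | j != i) F (u j)).
Proof.
rewrite (bigD1 i) //= {1}/upd eqxx; congr (op _ _).
by apply: eq_bigr => j /negbTE nji; rewrite /upd nji.
Qed.

(** * Polynomial functions with a degree bound *)

Section PolynomialFunctions.

Variables (I : finType) (R : comNzRingType).
Implicit Types (t : {ffun I -> R}) (f g : {ffun I -> R} -> R) (d e : nat).

(* [polyfun d f]: [f] is induced by a polynomial of total degree at most [d]. *)
Inductive polyfun : nat -> ({ffun I -> R} -> R) -> Prop :=
| polyfun_const d (c : R) : polyfun d (fun=> c)
| polyfun_var (i : I) : polyfun 1 (fun t => t i)
| polyfun_add d f g : polyfun d f -> polyfun d g ->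
    polyfun d (fun t => f t + g t)
| polyfun_mul d e f g : polyfun d f -> polyfun e g ->
    polyfun (d + e) (fun t => f t * g t)
| polyfun_leq d e f : (d <= e)%N -> polyfun d f -> polyfun e f
| polyfun_ext d f g : f =1 g -> polyfun d f -> polyfun d g.

Lemma polyfun_subC d f c : polyfun d f -> polyfun d (fun t => f t - c).
Proof. by move=> hf; apply: polyfun_add => //; apply: polyfun_const. Qed.

Lemma polyfun_sum (J : Type) (s : seq J) d (F : J -> {ffun I -> R} -> R) :
  (forall j, polyfun d (F j)) -> polyfun d (fun t => \sum_(j <- s) F j t).
Proof.
move=> hF; elim: s => [|j s IHs].
  by apply: polyfun_ext (polyfun_const d 0) => t; rewrite big_nil.
by apply: polyfun_ext (polyfun_add (hF j) IHs) => t; rewrite big_cons.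
Qed.

Lemma polyfun_prod (J : Type) (s : seq J) (Q : pred J) (d : J -> nat)
    (F : J -> {ffun I -> R} -> R) :
  (forall j, polyfun (d j) (F j)) ->
  polyfun (\sum_(j <- s | Q j) d j)%N (fun t => \prod_(j <- s | Q j) F j t).
Proof.
move=> hF; elim: s => [|j s IHs].
  by rewrite big_nil; apply: polyfun_ext (polyfun_const 0 1) => t;
     rewrite big_nil.
rewrite big_cons; case: ifP => hj.
  by apply: polyfun_ext (polyfun_mul (hF j) IHs) => t; rewrite big_cons hj.
by apply: polyfun_ext IHs => t; rewrite big_cons hj.
Qed.

Lemma polyfun_upd d f i c :
  polyfun d f -> polyfun d (fun t => f (finfun (upd t i c))).
Proof.
elim=> {d f} [d c'|j|d f g _ hf _ hg|d e f g _ hf _ hg|d e f hde _ hf|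
              d f g hfg _ hf].
- exact: polyfun_const.
- have [->|nij] := eqVneq j i.
    by apply: polyfun_ext (polyfun_const 1 c) => t; rewrite ffunE /upd eqxx.
  by apply: polyfun_ext (polyfun_var j) => t; rewrite ffunE /upd (negbTE nij).
- exact: polyfun_add.
- exact: polyfun_mul.
- exact: polyfun_leq hf.
- by apply: polyfun_ext hf => t.
Qed.

(** This is division by [t i - c], carried out along the derivation of [polyfun]. The clause for
    [d = 0] is needed because [d.-1] is then no smaller than [d], so the degree bound alone would
    not make the quotient vanish. *)
Lemma polyfun_factor d f i c : polyfun d f ->
  exists g, [/\ polyfun d.-1 g, d = 0%N -> g =1 (fun=> 0) &
    forall t, f t = f (finfun (upd t i c)) + (t i - c) * g t].
Proof.
elim=> {d f} [d c'|j|d f g _ [f' [Pf f0 Ef]] _ [g' [Pg g0 Eg]]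
  |d e f g Hf [f' [Pf f0 Ef]] Hg [g' [Pg g0 Eg]]
  |d e f hde _ [f' [Pf f0 Ef]]|d f g hfg _ [f' [Pf f0 Ef]]].
- exists (fun=> 0); split=> //; first exact: polyfun_const.
  by move=> t; rewrite mulr0 addr0.
- have [->|nij] := eqVneq j i.
    exists (fun=> 1); split=> //; first exact: polyfun_const.
    by move=> t; rewrite ffunE /upd eqxx mulr1 addrC subrK.
  exists (fun=> 0); split=> //; first exact: polyfun_const.
  by move=> t; rewrite ffunE /upd (negbTE nij) mulr0 addr0.
- exists (fun t => f' t + g' t); split; first exact: polyfun_add.
    by move=> d0 t; rewrite f0 // g0 // addr0.
  by move=> t; rewrite Ef Eg; ring.
(* With a subscript [c] for the substitution, the witness comes from [f g - f_c g_c = (f - f_c) g +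
   f_c (g - g_c)]. *)
- exists (fun t => f' t * g t + f (finfun (upd t i c)) * g' t); split.
  + have Hf0 := polyfun_upd i c Hf.
    case: d e => [|d] [|e] /= in Hf Pf f0 Hg Pg g0 Hf0 *.
    * apply: polyfun_ext (polyfun_const 0 0) => t.
      by rewrite f0 // g0 // mul0r mulr0 addr0.
    * apply: polyfun_ext (polyfun_mul Hf0 Pg) => t.
      by rewrite f0 // mul0r add0r.
    * apply: polyfun_ext (polyfun_mul Pf Hg) => t.
      by rewrite g0 // mulr0 addr0.
    * apply: polyfun_add; first exact: polyfun_mul.
      by rewrite addnS -addSn; apply: polyfun_mul.
  + move=> /eqP; rewrite addn_eq0 => /andP[/eqP d0 /eqP e0] t.
    by rewrite f0 // g0 // mul0r mulr0 addr0.
  + by move=> t; rewrite Ef mulrDl {1}(Eg t); ring.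
- exists f'; split=> //; first by apply: polyfun_leq Pf; lia.
  by move=> e0; apply: f0; lia.
- by exists f'; split=> // t; rewrite -!hfg.
Qed.

End PolynomialFunctions.

(** * Grids: interpolation with divisibility, and counting nonzeros *)

Section Grids.

Variables (I : finType) (R : finComUnitRingType).
Implicit Types (t : {ffun I -> R}) (A : I -> {set R}).

Definition grid A : {set {ffun I -> R}} :=
  [set t : {ffun I -> R} | [forall i, t i \in A i]].

Lemma gridP A t : reflect (forall i, t i \in A i) (t \in grid A).
Proof. by rewrite inE; apply: forallP. Qed.

Lemma grid_upd A t i (C : {set R}) : t \in grid A -> t i \in C ->
  t \in grid (upd A i C).
Proof.
move=> /gridP tA tC; apply/gridP => j; rewrite /upd.
by case: eqVneq => [->|].
Qed.

Lemma upd_grid A t i c : t \in grid A ->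
  finfun (upd t i c) \in grid (upd A i [set c]).
Proof.
move=> /gridP tA; apply/gridP => j; rewrite ffunE /upd.
by case: eqVneq; rewrite ?set11.
Qed.


Lemma sum_card_upd A i (C : {set R}) :
  (\sum_j #|upd A i C j| = #|C| + \sum_(j | j != i) #|A j|)%N.
Proof. exact: (big_upd addn (fun D : {set R} => #|D|)). Qed.

(* Newton interpolation: since the differences of nodes are units, the
   interpolation coefficients inherit divisibility by [z] from the values. *)
Lemma polyfun_divides (z : R) A d f :
  (forall i, {in A i &, forall a b, a != b -> a - b \is a GRing.unit}) ->
  polyfun d f -> {in grid A, forall t, exists b, f t = z * b} ->
  exists2 g, polyfun d g & {in grid A, forall t, f t = z * g t}.
Proof.
have [m] := ubnP (\sum_i #|A i|)%N.
elim: m => // m IHm in A d f * => ltm unitA Pf fz.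
(* If every side has at most one element, the grid has at most one point and a constant suffices. *)
case: (pickP (fun i => 1 < #|A i|)%N) => [i Ai|small]; last first.
  case: (pickP (mem (grid A))) => [a /= aA|A0]; last first.
    exists (fun=> 0); first exact: polyfun_const.
    by move=> t; have /= -> := A0 t.
  have [b fb] := fz _ aA; exists (fun=> b); first exact: polyfun_const.
  move=> t tA; rewrite -fb; congr f; apply/ffunP => i.
  have /card_le1_eqP : (#|A i| <= 1)%N by rewrite leqNgt small.
  by move=> /(_ (a i) (t i)) -> //; [move/gridP: aA | move/gridP: tA].
have [c cA] : exists c, c \in A i by apply/card_gt0P; apply: ltnW.
have [g [Pg g0 fE]] := polyfun_factor i c Pf.
have sumA : (\sum_j #|A j| = #|A i| + \sum_(j | j != i) #|A j|)%N.
  by rewrite (bigD1 i).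
have [] := IHm (upd A i [set c]) d f => //.
- by move: ltm; rewrite sum_card_upd cards1 sumA; lia.
- move=> j; rewrite /upd; case: eqP => // _ a b.
  by rewrite !inE => /eqP-> /eqP->; rewrite eqxx.
- move=> t /gridP tA; apply: fz; apply/gridP => j.
  by have := tA j; rewrite /upd; case: eqP => // -> /set1P ->.
move=> f1 Pf1 f1E.
have fcE t : t \in grid A ->
    f (finfun (upd t i c)) = z * f1 (finfun (upd t i c)).
  by move=> tA; apply/f1E/upd_grid.
have [] := IHm (upd A i (A i :\ c)) d.-1 g => //.
- by move: ltm; rewrite sum_card_upd sumA (cardsD1 c (A i)) cA; lia.
- move=> j; rewrite /upd; case: eqP => // _ a b.
  by move=> /setD1P[_ aA] /setD1P[_ bA]; exact: (unitA i).
- move=> t /gridP tA'.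
  have tA : t \in grid A.
    apply/gridP => j; have := tA' j; rewrite /upd.
    by case: eqP => // -> /setD1P[].
  have /setD1P[tic _]: t i \in A i :\ c by have := tA' i; rewrite /upd eqxx.
  have uc : t i - c \is a GRing.unit by apply: unitA => //; move/gridP: tA.
  have [b fb] := fz _ tA.
  (* Solve [z * b = z * f1(t_c) + (t i - c) * g t] for [g t], where [t_c] is [t] with coordinate [i]
     set to [c]. *)
  exists ((t i - c)^-1 * (b - f1 (finfun (upd t i c)))).
  apply: (mulrI uc); rewrite mulrCA mulVKr //.
  by rewrite mulrBr -fcE // -fb (fE t) [RHS]addrC addKr.
move=> g1 Pg1 g1E.
(* For [d = 0] the second term would have degree bound 1; it is replaced by 0, which is correct as
   [g] then vanishes. *)
exists (fun t => f1 (finfun (upd t i c)) +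
    (if d == 0%N then 0 else (t i - c) * g1 t)).
  apply: polyfun_add; first exact: polyfun_upd.
  case: eqP => [_|d0]; first exact: polyfun_const.
  have -> : d = (1 + d.-1)%N by lia.
  by apply: polyfun_mul => //; apply/polyfun_subC/polyfun_var.
move=> t tA; rewrite mulrDr -fcE // fE; congr (_ + _).
case: eqP => [d0|_]; first by rewrite g0 // !mulr0.
(* Nothing is known about [g1] on the slice [t i = c], but there the factor [t i - c] is zero. *)
have [->|tic] := eqVneq (t i) c; first by rewrite subrr !(mul0r, mulr0).
rewrite g1E; first by rewrite mulrCA.
by apply: grid_upd => //; rewrite in_setD1 tic (gridP _ _ tA).
Qed.

(* Deleting a slice of the grid on which [f] vanishes lowers the degree by one.
   If no slice in direction [i] vanishes, the slice with the fewest nonzeros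
   bounds all of them. *)
Lemma alon_furedi (F : fieldType) (rho : {rmorphism R -> F}) A d f :
  (forall i, {in A i &, injective rho}) -> polyfun d f ->
  (exists2 t, t \in grid A & rho (f t) != 0) ->
  exists y : I -> nat, [/\ forall i, (1 <= y i <= #|A i|)%N,
    (\sum_i #|A i| <= \sum_i y i + d)%N &
    (\prod_i y i <= #|[set t in grid A | rho (f t) != 0%R]|)%N].
Proof.
have [m] := ubnP (\sum_i #|A i|)%N.
elim: m => // m IHm in A d f * => ltm injA Pf [a aA fa].
have Agt0 i : (0 < #|A i|)%N.
  by apply/card_gt0P; exists (a i); move/gridP: aA.
case: (pickP (fun i => 1 < #|A i|)%N) => [i Ai|small]; last first.
  exists (fun=> 1%N); split.
  - by move=> i; rewrite Agt0.
  - apply: leq_trans (leq_addr _ _); apply: leq_sum => i _.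
    by rewrite leqNgt small.
  - by rewrite big1 // card_gt0; apply/set0Pn; exists a; rewrite inE aA.
have sumA : (\sum_j #|A j| = #|A i| + \sum_(j | j != i) #|A j|)%N.
  by rewrite (bigD1 i).
pose U c := [set t in grid (upd A i [set c]) | rho (f t) != 0].
case: (pickP (fun c => (c \in A i) && (U c == set0)))
    => [c /andP[cA /eqP Uc0]|Un0].
  have [g [Pg g0 fE]] := polyfun_factor i c Pf.
  (* As [f] vanishes modulo the kernel of [rho] on the slice at [c], its nonzeros are those of [g]
     off that slice. *)
  have rfE t : t \in grid A -> rho (f t) = rho (t i - c) * rho (g t).
    move=> tA; rewrite fE rmorphD rmorphM.
    suff /eqP -> : rho (f (finfun (upd t i c))) == 0 by rewrite add0r.
    apply: contraT => nz; have := in_set0 (finfun (upd t i c)).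
    by rewrite -Uc0 inE upd_grid ?nz.
  have ga : rho (a i - c) != 0 /\ rho (g a) != 0.
    by apply/andP; move: fa; rewrite rfE // mulf_eq0 negb_or.
  have d_gt0 : (0 < d)%N.
    rewrite lt0n; apply/eqP => d0.
    by have [_] := ga; rewrite g0 // rmorph0 eqxx.
  have subA j : upd A i (A i :\ c) j \subset A j.
    by rewrite /upd; case: eqP => [->|//]; apply: subD1set.
  have [||||y [y1 y2 y3]] := IHm (upd A i (A i :\ c)) d.-1 g.
  - by move: ltm; rewrite sum_card_upd sumA (cardsD1 c (A i)) cA; lia.
  - by move=> j b b' bA b'A; apply: injA; apply: (subsetP (subA j)).
  - by [].
  - exists a; last by case: ga.
    apply: grid_upd => //; rewrite in_setD1 (gridP _ _ aA) andbT.
    by apply: contraTneq (proj1 ga) => ->; rewrite subrr rmorph0 eqxx.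
  exists y; split.
  - by move=> j; have /andP[-> /leq_trans->] := y1 j; rewrite ?subset_leq_card.
  - by move: y2; rewrite sum_card_upd sumA (cardsD1 c (A i)) cA; lia.
  - apply: (leq_trans y3); apply: subset_leq_card; apply/subsetP => t.
    move=> /setIdP[/gridP tA' gt].
    have tA : t \in grid A.
      by apply/gridP => j; apply: (subsetP (subA j)).
    rewrite inE tA rfE // mulf_neq0 //.
    have /setD1P[tic tiA]: t i \in A i :\ c by have := tA' i; rewrite /upd eqxx.
    by rewrite rmorphB subr_eq0; apply: contra tic => /eqP/(injA i)->.
have [c0 c0A minc] : exists2 c, c \in A i &
    {in A i, forall b, (#|U c| <= #|U b|)%N}.
  have aiA : a i \in A i by move/gridP: aA.
  by case: (arg_minnP (fun c => #|U c|) aiA) => c cA h; exists c.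
have subA j : upd A i [set c0] j \subset A j.
  by rewrite /upd; case: eqP => [->|//]; rewrite sub1set.
have [||||y [y1 y2 y3]] := IHm (upd A i [set c0]) d f.
- by move: ltm; rewrite sum_card_upd sumA cards1; lia.
- by move=> j b b' bA b'A; apply: injA; apply: (subsetP (subA j)).
- by [].
- have /negbT := Un0 c0; rewrite c0A /= => /set0Pn[t].
  by rewrite inE => /andP[tA ft]; exists t.
have yi : y i = 1%N.
  by have := y1 i; rewrite /upd eqxx cards1; lia.
(* The smallest slice has one element on side [i], so [y i = 1]. Raising this entry to [#|A i|]
   multiplies the product by the number of slices and raises both sides of the sum inequality by
   [#|A i| - 1]. *)
exists (upd y i #|A i|); split.
- move=> j; rewrite {1 2}/upd; case: eqP => [->|nji].
    by rewrite leqnn (ltnW Ai).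
  by have := y1 j; rewrite /upd; case: eqP.
- have -> : (\sum_j upd y i #|A i| j = #|A i| + \sum_(j | j != i) y j)%N.
    exact: (big_upd addn id).
  move: y2; rewrite sum_card_upd cards1 sumA.
  have -> : (\sum_j y j = 1 + \sum_(j | j != i) y j)%N.
    by rewrite (bigD1 i) //= yi.
  by lia.
have -> : (\prod_j upd y i #|A i| j = #|A i| * \prod_j y j)%N.
  by rewrite [LHS](big_upd muln id) [in RHS](bigD1 i) //= yi mul1n.
rewrite -[X in (_ <= X)%N]sum1_card.
(* Sort the nonzeros by coordinate [i]; each class is as large as the smallest slice or larger. *)
rewrite (partition_big (fun t : {ffun I -> R} => t i) (mem (A i))); last first.
  by move=> t /setIdP[/gridP tA _]; apply: tA.
rewrite -sum_nat_const; apply: leq_sum => b bA.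
apply: (leq_trans y3); apply: (leq_trans (minc b bA)).
rewrite sum1_card; apply: subset_leq_card; apply/subsetP => t.
rewrite inE => /andP[/gridP tA ft].
have tib : t i = b by have := tA i; rewrite /upd eqxx => /set1P.
rewrite unfold_in /= inE ft tib eqxx !andbT; apply/gridP => j.
by have := tA j; rewrite /upd; case: eqP => // -> _; rewrite tib.
Qed.

End Grids.

(** * Polynomials that detect congruence conditions *)

Section Detectors.

Variables (I : finType) (R : finComUnitRingType) (F : finFieldType).
Variables (rho : {rmorphism R -> F}) (s0 : F -> R) (z : R) (v : nat).
Hypothesis s0K : cancel s0 rho.
Hypothesis rho_unit : forall a, (a \is a GRing.unit) = (rho a != 0).
Hypothesis rho_eq0 : forall a, rho a = 0 <-> exists b, a = z * b.
(** In the application [z] is nilpotent and cannot be cancelled outright; below the length,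
    cancelling it still preserves divisibility by [z ^+ k]. *)
Hypothesis z_cancel : forall k a b, (k < v)%N -> z * a = z ^+ k.+1 * b ->
  exists c, a = z ^+ k * c.

Lemma section_extending (B : {set R}) : {in B &, injective rho} ->
  exists2 s : F -> R, cancel s rho & {in B, cancel rho s}.
Proof.
move=> injB; exists (fun u => odflt (s0 u) [pick b in B | rho b == u]).
  by move=> u; case: pickP => [b /andP[_ /eqP]|_] //=; apply: s0K.
move=> b bB; case: pickP => [b' /andP[b'B /eqP]|/(_ b)].
  exact: injB.
by rewrite bB eqxx.
Qed.

(** The image in [F] is the product of the [rho h - u], which vanishes exactly when [u = rho h]
    occurs among the factors. *)
Lemma rho_prod_subr (h : R) (s : F -> R) (P : pred F) : cancel s rho ->
  (rho (\prod_(u | P u) (h - s u)) != 0) = ~~ P (rho h).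
Proof.
move=> sK; rewrite rmorph_prod; apply/prodf_neq0/idP => [h0|Ph u Pu].
  by apply/negP => /h0; rewrite rmorphB sK subrr eqxx.
by rewrite rmorphB sK subr_eq0; apply: contraNneq Ph => ->.
Qed.

(* The recursion replaces [h] by [h' = (\prod_u (h - s u)) / z], where [s] is a
   section of [rho] through [B]: if [h] is congruent to [b \in B] modulo [z],
   then [h'] is [(h - b) / z] times a unit. *)
Lemma polyfun_detector (A : I -> {set R}) (w d : nat) h (B : {set R}) :
  (forall i, {in A i &, forall a b, a != b -> a - b \is a GRing.unit}) ->
  polyfun d h -> {in B &, injective rho} -> (0 < w <= v)%N ->
  exists2 g, polyfun (d * (#|F| ^ w - #|B|)) g &
    {in grid A, forall t, rho (g t) != 0 <->
      exists2 b, b \in B & exists c, h t - b = z ^+ w * c}.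
Proof.
move=> unitA; elim: w d h B => // w IHw d h B Ph injB wv.
have [s sK sB] := section_extending injB.
pose g1 t := \prod_(u | u \notin rho @: B) (h t - s u).
have cardB : #|[set rho b | b in B]| = #|B|.
  exact: card_in_imset.
have leB : (#|B| <= #|F|)%N by rewrite -cardB max_card.
have Pg1 : polyfun (d * (#|F| - #|B|)) g1.
  have -> : (d * (#|F| - #|B|) = \sum_(u | u \notin rho @: B) d)%N.
    rewrite sum_nat_const mulnC; congr muln.
    rewrite -cardB -(cardsC (rho @: B)) addKn.
    by apply: eq_card => u; rewrite !inE.
  by apply: polyfun_prod => u; apply: polyfun_subC.
have g1E t : (rho (g1 t) != 0) = (rho (h t) \in rho @: B).
  by rewrite rho_prod_subr // negbK.
(* Exponent 1 is treated apart, since the induction hypothesis is void at exponent 0. *)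
case: w => [|w] in IHw wv *.
  exists g1; rewrite ?expn1 // => t _; rewrite g1E.
  split=> [/imsetP[b bB hb]|[b bB hb]].
    exists b => //; apply/rho_eq0; rewrite rmorphB hb subrr //.
  apply/imsetP; exists b => //; apply/eqP; rewrite -subr_eq0 -rmorphB.
  by apply/eqP/rho_eq0.
have Pp : polyfun (d * #|F|) (fun t => \prod_u (h t - s u)).
  have -> : (d * #|F| = \sum_(u : F) d)%N by rewrite sum_nat_const mulnC.
  by apply: polyfun_prod => u; apply: polyfun_subC.
have [|h' Ph' hE] := @polyfun_divides _ _ z A _ _ unitA Pp.
  move=> t _; apply/rho_eq0/eqP; rewrite -[_ == 0]negbK.
  by rewrite (rho_prod_subr (h t) predT).
(* What remains to be detected is [h' = 0] modulo the lower power, hence the set [[set 0]]. *)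
have [||g' Pg' g'E] := IHw _ _ [set 0] Ph'.
- by move=> a b; rewrite !inE => /eqP-> /eqP->.
- by case/andP: wv => _ /ltnW.
exists (fun t => g1 t * g' t).
  (* The degrees telescope: [q^(w+2) - #B = (q - #B) + q (q^(w+1) - 1)]. *)
  suff -> : (d * (#|F| ^ w.+2 - #|B|) =
      d * (#|F| - #|B|) + d * #|F| * (#|F| ^ w.+1 - #|[set 0%R : R]|))%N.
    exact: polyfun_mul.
  rewrite cards1 -mulnA -mulnDr; congr muln; rewrite mulnBr muln1 -expnS.
  have : (#|F| <= #|F| ^ w.+2)%N.
    by rewrite -[X in (X <= _)%N]expn1 leq_pexp2l //; apply/card_gt0P; exists 0.
  by lia.
move=> t tA; rewrite rmorphM mulf_eq0 negb_or g1E.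
(* The factor at [u = rho b] is [h t - b], because [s] extends [B]; all the other factors are
   units. *)
have splitE b : b \in B -> rho (h t) = rho b ->
    exists2 e, e \is a GRing.unit & z * h' t = (h t - b) * e.
  move=> bB hb; exists (\prod_(u | u != rho b) (h t - s u)).
    by rewrite rho_unit rho_prod_subr // hb eqxx.
  by rewrite -hE // (bigD1 (rho b)) //= sB.
split.
  move=> /andP[/imsetP[b bB hb] /(g'E t tA)[b0]].
  rewrite inE => /eqP-> [c]; rewrite subr0 => h'c.
  have [e ue he] := splitE b bB hb.
  exists b => //; exists (c / e); apply: (mulIr ue).
  by rewrite -he h'c -[RHS]mulrA divrK // [in RHS]exprS mulrA.
move=> [b bB [c hc]].
have hb : rho (h t) = rho b.
  apply/eqP; rewrite -subr_eq0 -rmorphB; apply/eqP/rho_eq0.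
  by exists (z ^+ w.+1 * c); rewrite hc exprS mulrA.
rewrite hb imset_f //=; apply/(g'E t tA); exists 0; rewrite ?inE ?eqxx //.
have [e ue he] := splitE b bB hb.
rewrite subr0; apply: (z_cancel (b := c * e)); first by case/andP: wv.
by rewrite he hc mulrA.
Qed.

End Detectors.

(** * Ideals and units in finite local principal rings *)

Section LocalPrincipal.

Variable (R : finComUnitRingType).
Implicit Types (I J : {set R}) (z : R).

Definition principal_ideal z : {set R} := [set z * x | x : R].

Lemma principal_idealP z a :
  reflect (exists b, a = z * b) (a \in principal_ideal z).
Proof. by apply: (iffP imsetP) => [[b _ ->]|[b ->]]; exists b. Qed.

Lemma is_ideal_principal z : is_ideal (principal_ideal z).
Proof.
apply/andP; split; first by apply/principal_idealP; exists 0; rewrite mulr0.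
apply/forallP => a; apply/forall_inP => _ /principal_idealP[b ->].
apply/forall_inP => _ /principal_idealP[c ->].
by apply/principal_idealP; exists (a * b + c); ring.
Qed.

Lemma is_idealM I a x : is_ideal I -> x \in I -> a * x \in I.
Proof.
move=> /andP[I0 /forallP/(_ a)/forall_inP IP] xI.
by rewrite -[a * x]addr0; apply: (forall_inP (IP x xI)).
Qed.

Lemma ideal_mul_principal z1 z2 :
  ideal_mul (principal_ideal z1) (principal_ideal z2) =
  principal_ideal (z1 * z2).
Proof.
apply/eqP; rewrite eqEsubset; apply/andP; split.
  apply: bigcap_inf; rewrite is_ideal_principal /=.
  apply/subsetP => _ /imset2P[_ _ /principal_idealP[a ->]
    /principal_idealP[b ->] ->].
  by apply/principal_idealP; exists (a * b); ring.
apply/subsetP => _ /principal_idealP[b ->].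
apply/bigcapP => I /andP[_ /subsetP]; apply.
rewrite -mulrA; apply: imset2_f; apply/principal_idealP.
  by exists 1; rewrite mulr1.
by exists b.
Qed.

Lemma ideal_exp_principal z k :
  ideal_exp (principal_ideal z) k = principal_ideal (z ^+ k).
Proof.
elim: k => [|k IHk]; last by rewrite exprS -ideal_mul_principal -IHk.
by apply/esym/setP => a; rewrite inE; apply/principal_idealP; exists a;
   rewrite mul1r.
Qed.

(** A nonunit generates a proper ideal, which lies in some maximal ideal, and that can only be
    [I]. *)
Lemma local_ring_unit I a : local_ring I ->
  (a \is a GRing.unit) = (a \notin I).
Proof.
move=> locI; apply/idP/idP => [ua|].
  have /maxsetP[/andP[idI] /negP IT _] : maximal_ideal I by apply/locI.
  apply/negP => aI; apply/IT/eqP/setP => x; rewrite inE.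
  by rewrite -[x](divrK ua); apply: is_idealM.
apply: contraR => nua.
have properA : proper_ideal_set (principal_ideal a).
  rewrite /proper_ideal_set is_ideal_principal /=.
  apply: contra nua => /eqP aT.
  have /principal_idealP[b ab] : 1 \in principal_ideal a by rewrite aT inE.
  by apply/unitrPr; exists b.
have [J maxJ /subsetP] := maxset_exists properA.
have -> : J = I by apply/locI.
by apply; apply/principal_idealP; exists 1; rewrite mulr1.
Qed.

(** The point is that [z * c = 0] forces [c] into [(z^k)] for [k < v]. By induction write
    [c = z^k d]; if [d] were a unit, [z^(k+1)] would vanish, against [z^(v-1) != 0], so [d] is a
    multiple of [z]. This is applied to [a - z^k b]. *)
Lemma local_cancel z v k a b :
  (forall c, c \isn't a GRing.unit -> exists d, c = z * d) ->
  z ^+ v.-1 != 0 -> (k < v)%N -> z * a = z ^+ k.+1 * b ->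
  exists c, a = z ^+ k * c.
Proof.
move=> zP zv kv zab.
have ann : forall c, z * c = 0 -> exists d, c = z ^+ k * d.
  move=> c zc; elim: k kv {zab} => [|k IHk] kv.
    by exists c; rewrite mul1r.
  have [d cd] := IHk (ltnW kv).
  have [ud|/zP[e de]] := boolP (d \is a GRing.unit); last first.
    by exists e; rewrite cd de exprSr mulrA.
  have zk0 : z ^+ k.+1 = 0.
    by apply: (mulIr ud); rewrite mul0r -zc cd exprS mulrA.
  case/negP: zv; have -> : v.-1 = (k.+1 + (v.-1 - k.+1))%N by lia.
  by rewrite exprD zk0 mul0r.
have [|c hc] := ann (a - z ^+ k * b).
  by rewrite mulrBr zab exprS mulrA subrr.
by exists (c + b); rewrite mulrDr -hc subrK.
Qed.

End LocalPrincipal.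

(** * From solutions in the span to coefficient vectors on a grid *)

Section Coordinates.

Variables (R : finComUnitRingType) (n N : nat) (f : 'I_n -> {mpoly R[N]}).
Hypothesis hf : lin_indep f.

Lemma lincomb_inj : injective (lincomb f).
Proof.
move=> c d cd; apply/ffunP => i; apply/eqP; rewrite -subr_eq0.
suff /(_ i) : forall i, [ffun j => c j - d j] i = 0 by rewrite ffunE => ->.
apply: hf; move/eqP: cd; rewrite -subr_eq0 -sumrB => /eqP <-.
by apply: eq_bigr => j _; rewrite ffunE scalerBl.
Qed.

Lemma lincombK : cancel (lincomb f) (coords f).
Proof.
move=> c; rewrite /coords; case: pickP => [d /eqP/lincomb_inj //|/(_ c)].
by rewrite eqxx.
Qed.

Lemma meval_lincomb (x : 'I_N -> R) c :
  (lincomb f c).@[x] = \sum_i c i * (f i).@[x].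
Proof. by rewrite raddf_sum; apply: eq_bigr => i _; apply: mevalZ. Qed.

Variables (P : {set R}) (r : nat) (x : 'I_r -> {ffun 'I_N -> R}).
Variables (A : 'I_n -> {set R}) (B : 'I_r -> {set R}) (w : 'I_r -> nat).

Lemma lincomb_solutions c :
  (lincomb f c \in solutions f P x A B w) =
  (c \in grid A) &&
  [forall j, in_mod (B j) (ideal_exp P (w j)) (lincomb f c).@[x j]].
Proof.
rewrite !inE /= lincombK; apply: andb_idl => _.
by apply/imfsetP; exists c.
Qed.

Lemma card_solutions :
  #|` solutions f P x A B w|%fset =
  #|[set c in grid A | [forall j,
      in_mod (B j) (ideal_exp P (w j)) (lincomb f c).@[x j]]]|.
Proof.
set C := [set c in _ | _].
suff -> : solutions f P x A B w = [fset lincomb f c | c in C]%fset.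
  by rewrite card_imfset; [rewrite cardE | apply: lincomb_inj].
apply/fsetP => g; apply/idP/imfsetP => [gS|[c /= cC ->]]; last first.
  by rewrite lincomb_solutions; move: cC; rewrite inE.
have /imfsetP[c _ gc] : g \in span f by move: gS; rewrite !inE => /andP[].
by exists c => //=; rewrite inE -lincomb_solutions -gc.
Qed.

End Coordinates.

(** * Bounding [frakm] from above *)

Lemma exists_sum_between (I : finType) (y : I -> nat) (m : nat) :
  (forall i, 0 < y i)%N -> (#|I| <= m <= \sum_i y i)%N ->
  exists2 y' : I -> nat, (forall i, 0 < y' i <= y i)%N & (\sum_i y' i)%N = m.
Proof.
have [k] := ubnP (\sum_i y i - m)%N.
elim: k y => // k IHk y lek ygt0 /andP[Im my].
have [ym|ym] := eqVneq (\sum_i y i)%N m.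
  by exists y => // i; rewrite ygt0 leqnn.
(* Were all entries 1, the sum could not exceed [m]. An entry above 1 can be lowered by one and
   stays positive. *)
have [i yi] : exists i, (1 < y i)%N.
  apply/existsP; apply: contraNT ym => /existsPn y1.
  suff : (\sum_i y i <= #|I|)%N by lia.
  by rewrite -sum1_card; apply: leq_sum => i _; rewrite leqNgt.
have sumy : (\sum_j y j = y i + \sum_(j | j != i) y j)%N by rewrite (bigD1 i).
have sumu : (\sum_j upd y i (y i).-1 j =
    (y i).-1 + \sum_(j | j != i) y j)%N by exact: (big_upd addn id).
have [||| y' y'P y'm] := IHk (upd y i (y i).-1).
- by rewrite sumu; lia.
- by move=> j; rewrite /upd; case: eqP => // _; lia.
- by rewrite sumu Im; lia.
exists y' => // j; have := y'P j; rewrite /upd.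
by case: eqP => [->|//]; lia.
Qed.

Lemma bigminn_leq (I : finType) (P : pred I) (F : I -> nat) (m : nat) (j : I) :
  P j -> (\big[minn/m]_(i | P i) F i <= F j)%N.
Proof.
rewrite -Order.NatOrder.minEnat -Order.NatOrder.leEnat.
exact: Order.TotalTheory.bigmin_le_cond.
Qed.

(** Counting nonzeros yields a tuple whose sum is only at least [M]; lowering its entries to reach
    sum [M] does not increase the product. *)
Lemma frakm_le (n : nat) (a y : 'I_n -> nat) (M : int) :
  (forall i, 1 <= y i <= a i)%N -> M <= (\sum_i y i)%N%:Z ->
  (frakm a M <= \prod_i y i)%N.
Proof.
move=> yP My; rewrite /frakm; case: ifP => nM.
  by rewrite prodn_gt0 // => i; have /andP[] := yP i.
have [m Mm] : exists m : nat, M = m%:Z by exists `|M|%N; lia.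
have [||y' y'P y'm] := @exists_sum_between _ y m.
- by move=> i; have /andP[] := yP i.
- by rewrite card_ord; lia.
have y'a i : (y' i < (\sum_i a i).+1)%N.
  rewrite ltnS (bigD1 i) //=; apply: leq_trans (leq_addr _ _).
  by have := y'P i; have := yP i; lia.
pose Y := [ffun i => Ordinal (y'a i)].
apply: (@leq_trans (\prod_i Y i)%N).
  apply: (@bigminn_leq _ _ _ _ Y); apply/andP; split.
    apply/forallP => i; rewrite ffunE /=.
    by have := y'P i; have := yP i; lia.
  rewrite Mm -y'm; apply/eqP; congr Posz.
  by apply: eq_bigr => i _; rewrite ffunE.
by apply: leq_prod => i _; rewrite ffunE; have /andP[] := y'P i.
Qed.

(** * Counting solutions by the nonzeros of one polynomial *)

Theorem theorem3p19 (R : finComUnitRingType) (p : idealr R)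
    (hprincipal : principal_ring R)
    (hlocal : local_ring [set x in p])
    (q : nat) (F : finFieldType) (hq : #|F| = q)
    (phi : {rmorphism {ideal_quot p} -> F}) (hphi : bijective phi)
    (v : nat) (hv : ring_length [set x in p] v)
    (n N r : nat) (hn : (0 < n)%N) (hN : (0 < N)%N) (hr : (0 < r)%N)
    (f : 'I_n -> {mpoly R[N]}) (hf : lin_indep f)
    (x : 'I_r -> {ffun 'I_N -> R}) (hx : injective x)
    (A : 'I_n -> {set R}) (hA : forall i, condF (A i))
    (B : 'I_r -> {set R}) (hB : forall j, condF (B j))
    (w : 'I_r -> nat) (hw : forall j, (1 <= w j <= v)%N) :
  let S := solutions f [set x in p] x A B w in
  let M : int := \sum_(i < n) #|A i|%:Z
                 - \sum_(j < r) ((q ^ w j)%N%:Z - #|B j|%:Z) in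
  (#|` S|%fset = 0%N \/ (frakm (fun i => #|A i|) M <= #|` S|%fset)%N)
  /\ ((forall i, 0 \in A i) -> (forall j, 0 \in B j) -> n%:Z < M ->
      exists2 g : {mpoly R[N]}, g \in S & g != 0).
Proof.
move=> S M.
have ideal_p : is_ideal [set x in p].
  by have /maxsetP[/andP[]] : maximal_ideal [set x in p] by apply/hlocal.
have [z pz] := hprincipal _ ideal_p; rewrite -/(principal_ideal z) in pz.
pose rho : {rmorphism R -> F} := phi \o \pi_{ideal_quot p}%qT.
have rho_p a : (rho a == 0) = (a \in p).
  rewrite -[in RHS](subr0 a) Quotient.idealrBE.
  have -> : (rho a == 0) = (rho a == rho 0) by rewrite rmorph0.
  by rewrite /= (inj_eq (bij_inj hphi)).
have rho_unit a : (a \is a GRing.unit) = (rho a != 0).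
  by rewrite (local_ring_unit _ hlocal) inE rho_p.
have rho_eq0 a : rho a = 0 <-> exists b, a = z * b.
  have -> : rho a = 0 <-> a \in principal_ideal z.
    by rewrite -pz inE -rho_p; split=> [/eqP|/eqP].
  by split=> /principal_idealP.
have [s0 s0K] : exists s0 : F -> R, cancel s0 rho.
  have [psi psiK phiK] := hphi.
  exists (fun u => repr (psi u)) => u /=.
  by rewrite reprK phiK.
have [v_gt0 zv _] := hv; rewrite pz ideal_exp_principal in zv.
have zv0 : z ^+ v.-1 != 0.
  apply/eqP => z0; apply: zv; apply/setP => a; rewrite z0 inE.
  apply/principal_idealP/eqP => [[b ->]|->]; first by rewrite mul0r.
  by exists 0; rewrite mul0r.
have z_cancel k a b : (k < v)%N -> z * a = z ^+ k.+1 * b ->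
    exists c, a = z ^+ k * c.
  apply: local_cancel => // c; rewrite rho_unit negbK => /eqP.
  by move/rho_eq0.
have unitA i := (hA i).2; have unitB j := (hB j).2.
have rho_inj (C : {set R}) : condF C -> {in C &, injective rho}.
  move=> [_ unitC] a b aC bC /eqP; rewrite -subr_eq0 -rmorphB.
  by apply: contraTeq => /(unitC _ _ aC bC); rewrite rho_unit.
(* Evaluation at [x j] is linear in the coefficients, so the detector applies with degree 1. *)
have detect j : exists2 g, polyfun (q ^ w j - #|B j|) g &
    {in grid A, forall c, (rho (g c) != 0) =
      in_mod (B j) (ideal_exp [set x in p] (w j)) (lincomb f c).@[x j]}.
  have Pl : polyfun 1 (fun c : {ffun 'I_n -> R} => (lincomb f c).@[x j]).
    apply: (@polyfun_ext _ _ _ (fun c => \sum_i c i * (f i).@[x j])).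
      by move=> c; rewrite meval_lincomb.
    apply: polyfun_sum => i; rewrite -[1%N]addn0.
    by apply: polyfun_mul; [apply: polyfun_var | apply: polyfun_const].
  have [g Pg gE] := polyfun_detector s0K rho_unit rho_eq0 z_cancel unitA Pl
    (rho_inj _ (hB j)) (hw j).
  rewrite mul1n hq in Pg; exists g => // c cA.
  rewrite pz ideal_exp_principal; apply/idP/exists_inP.
    move=> /(gE c cA)[b bB hb]; exists b => //.
    by apply/principal_idealP.
  move=> [b bB /principal_idealP hb]; apply/(gE c cA).
  by exists b.
pose D := (\sum_j (q ^ w j - #|B j|))%N.
have [G PG GE] : exists2 G, polyfun D G & {in grid A, forall c,
    (rho (G c) != 0) = (lincomb f c \in S)}.
  (* [G] is the product of the detectors, built along the list of indices; [F] being a field, it is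
     nonzero exactly when all of them are. *)
  have [G PG GE] : exists2 G, polyfun D G & {in grid A, forall c,
      (rho (G c) != 0) = all (fun j => in_mod (B j)
        (ideal_exp [set x in p] (w j)) (lincomb f c).@[x j]) (index_enum 'I_r)}.
    rewrite /D; elim: (index_enum _) => [|j s [G PG GE]].
      rewrite big_nil; exists (fun=> 1); first exact: polyfun_const.
      by move=> c _; rewrite rmorph1 oner_eq0.
    have [g Pg gE] := detect j; rewrite big_cons.
    exists (fun c => g c * G c) => [|c cA]; first exact: polyfun_mul.
    by rewrite rmorphM mulf_eq0 negb_or gE // GE.
  exists G => // c cA; rewrite GE // lincomb_solutions // cA /=.
  apply/allP/forallP => h j; first by rewrite h ?mem_index_enum.
  by rewrite h.
have cardS : #|` S|%fset = #|[set c in grid A | rho (G c) != 0]|.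
  rewrite card_solutions //; apply: eq_card => c.
  rewrite [in LHS]inE [in RHS]inE.
  case: (boolP (c \in grid A)) => //= cA.
  by rewrite GE // lincomb_solutions // cA.
(* This makes the truncated differences in [D] agree with the integer ones in [M]. *)
have cardB j : (#|B j| <= q ^ w j)%N.
  have leB : (#|B j| <= q)%N.
    by rewrite -hq -(card_in_imset (rho_inj _ (hB j))) max_card.
  apply: (leq_trans leB); rewrite -[X in (X <= _)%N]expn1.
  have /andP[w1 _] := hw j; rewrite leq_pexp2l // -hq.
  by apply/card_gt0P; exists 0.
have ME : M = (\sum_i #|A i|)%N%:Z - D%:Z.
  rewrite /M /D !(big_morph Posz PoszD (erefl _)); congr (_ - _).
  by apply: eq_bigr => j _; rewrite subzn.
have bound : #|` S|%fset != 0%N ->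
    exists y : 'I_n -> nat, [/\ forall i, (1 <= y i <= #|A i|)%N,
      M <= (\sum_i y i)%N%:Z & (\prod_i y i <= #|` S|%fset)%N].
  rewrite cardS -lt0n => /card_gt0P[c /setIdP[cA Gc]].
  have [|y [y1 y2 y3]] := alon_furedi (fun i => rho_inj _ (hA i)) PG.
    by exists c.
  by exists y; split=> //; rewrite ME; lia.
split.
  have [->|/bound[y [y1 y2 y3]]] := eqVneq #|` S|%fset 0%N; first by left.
  by right; apply: leq_trans y3; apply: frakm_le.
move=> A0 B0 nM.
have S0 : 0 \in S.
  have f0 : lincomb f [ffun=> 0] = 0.
    by rewrite /lincomb big1 // => i _; rewrite ffunE scale0r.
  rewrite -f0 lincomb_solutions //; apply/andP; split.
    by apply/gridP => i; rewrite ffunE.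
  apply/forallP => j; apply/exists_inP; exists 0; rewrite ?B0 //.
  rewrite f0 meval0 subr0 pz ideal_exp_principal; apply/principal_idealP.
  by exists 0; rewrite mulr0.
have [|y [y1 y2 y3]] := bound.
  by rewrite cardfs_eq0; apply/fset0Pn; exists 0.
(* The [n] entries sum to at least [M > n], so one exceeds 1. The product is then at least 2, which
   gives a solution besides 0. *)
have [i yi] : exists i, (1 < y i)%N.
  apply/existsP; apply: contraT => /existsPn ysmall.
  suff : (\sum_i y i <= n)%N by lia.
  rewrite -[X in (_ <= X)%N]card_ord -sum1_card; apply: leq_sum => i _.
  by rewrite leqNgt.
have S2 : (1 < #|` S|%fset)%N.
  apply: leq_trans y3; rewrite (bigD1 i) //=; apply: leq_trans yi _.
  by rewrite leq_pmulr // prodn_gt0 // => j; have /andP[] := y1 j.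
have : (0 < #|` (S `\ 0%R)%fset|)%N by rewrite (cardfsD1 0) S0 in S2.
rewrite cardfs_gt0 => /fset0Pn[g0]; rewrite in_fsetD1 => /andP[g0n g0S].
by exists g0.
Qed.
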